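(* The Hom complex $\mathrm{Hom}(C_5,K_4)$ is homeomorphic to the Stiefel manifold $V_{3,2}$, and hence to real projective $3$-space: $\mathrm{Hom}(C_5,K_4)\cong V_{3,2}\cong \mathbb{R}\mathbf{P}^3$.
   Context: $C_5$ is the cycle graph on $5$ vertices, $K_n$ is the complete graph on $\{1,\dots,n\}$. $V_{m,2}$ denotes the Stiefel manifold of orthonormal $2$-frames in $\mathbb{R}^m$. Hom complex: for finite simple graphs $G,H$, $\mathrm{Hom}(G,H)$ is the subcomplex of the direct product $\prod_{x\in V(G)}\Delta^{V(H)}$ (where $\Delta^{V(H)}$ is the simplex with vertex set $V(H)$, and the cells of the product are products of simplices, with the product topology) whose non-empty cells are the products $\prod_{x\in V(G)}\eta(x)$ indexed by functions $\eta:V(G)\to 2^{V(H)}\setminus\{\emptyset\}$ such that whenever $\{u,v\}\in E(G)$, every $a\in\eta(u)$ and $b\in\eta(v)$ satisfy $\{a,b\}\in E(H)$. The cell $\eta$ is a face of the cell $\eta'$ iff $\eta(x)\subseteq\eta'(x)$ for all $x\in V(G)$. *)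

(* Defs.v *)
From HB Require Import structures.
From mathcomp Require Import all_boot all_order all_algebra.
From mathcomp Require Import all_classical all_reals all_analysis.
Set Implicit Arguments.
Unset Strict Implicit.
Unset Printing Implicit Defensive.
Import Order.TTheory GRing.Theory Num.Theory numFieldNormedType.Exports.
Local Open Scope classical_set_scope.
Local Open Scope ring_scope.

Definition homeomorphic (X Y : topologicalType) : Prop :=
  exists (f : X -> Y) (g : Y -> X),
    [/\ continuous f, continuous g, cancel f g & cancel g f].

Record sgraph := SGraph {
  vertex :> finType;
  adj : rel vertex;
  adj_sym : symmetric adj;
  adj_irr : irreflexive adj }.

Definition complete_adj n : rel 'I_n := fun i j => i != j.

Lemma complete_adj_sym n : symmetric (@complete_adj n).
Proof. by move=> i j; rewrite /complete_adj eq_sym. Qed.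

Lemma complete_adj_irr n : irreflexive (@complete_adj n).
Proof. by move=> i; rewrite /complete_adj eqxx. Qed.

Definition complete_graph n : sgraph :=
  SGraph (@complete_adj_sym n) (@complete_adj_irr n).

(* [ordS i] is [i + 1] modulo [n].  The conjunct [i != j] only matters for
   [n = 1], where it discards a loop. *)
Definition cycle_adj n : rel 'I_n :=
  fun i j => (i != j) && ((ordS i == j) || (ordS j == i)).

Lemma cycle_adj_sym n : symmetric (@cycle_adj n).
Proof. by move=> i j; rewrite /cycle_adj eq_sym orbC. Qed.

Lemma cycle_adj_irr n : irreflexive (@cycle_adj n).
Proof. by move=> i; rewrite /cycle_adj eqxx. Qed.

Definition cycle_graph n : sgraph :=
  SGraph (@cycle_adj_sym n) (@cycle_adj_irr n).

Section HomComplex.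
Context (R : realType).

(* Barycentric coordinates: the vertex [a] of the simplex is the indicator
   function of [a]. *)
Definition coord_space (V : finType) : topologicalType :=
  prod_topology (fun _ : V => R).

Definition simplex (V : finType) : set (coord_space V) :=
  [set t | (forall a, 0 <= t a) /\ \sum_a t a = 1].

Definition simplex_face (V : finType) (S : {set V}) : set (coord_space V) :=
  [set t | simplex t /\ forall a, a \notin S -> t a = 0].

Context (G H : sgraph).

Definition multihom (eta : G -> {set H}) : Prop :=
  (forall x, eta x != finset.set0) /\
  (forall u v, adj u v -> forall a b, a \in eta u -> b \in eta v -> adj a b).

Definition hom_ambient : topologicalType :=
  prod_topology (fun _ : G => coord_space H).

Definition hom_cell (eta : G -> {set H}) : set hom_ambient :=
  [set p | forall x, simplex_face (eta x) (p x)].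

Definition hom_carrier : set hom_ambient :=
  \bigcup_(eta in multihom) hom_cell eta.

(* There are finitely many cells, so the subspace topology of the product
   agrees with the cellular topology. *)
Definition hom_complex : topologicalType := set_type hom_carrier.

End HomComplex.

Section Stiefel.
Context (R : realType).

Definition dot n (u v : 'rV[R]_n) : R := \sum_(i < n) u 0 i * v 0 i.

(* A [k]-frame in [R^m] is the [k x m] matrix whose rows are its vectors. *)
Definition orthonormal_frames (m k : nat) : set 'M[R]_(k, m) :=
  [set A | forall i j, dot (row i A) (row j A) = (i == j)%:R].

Definition stiefel (m k : nat) : topologicalType :=
  set_type (@orthonormal_frames m k).

End Stiefel.

Section Projective.
Context (R : realType) (n : nat).

Definition nonzero_vectors : set 'rV[R]_n.+1 := [set v | v != 0].

Definition same_line : rel nonzero_vectors :=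
  fun u v => `[< exists2 c : R, c != 0 & \val v = c *: \val u >].

Lemma same_line_refl : reflexive same_line.
Proof. by move=> u; apply/asboolP; exists 1; rewrite ?oner_eq0 ?scale1r. Qed.

Lemma same_line_sym : symmetric same_line.
Proof.
move=> u v; apply/asboolP/asboolP => -[c c0 ->]; exists c^-1;
  by rewrite ?invr_eq0// scalerA mulVf// scale1r.
Qed.

Lemma same_line_trans : transitive same_line.
Proof.
move=> v u w /asboolP[c c0 vE] /asboolP[d d0 wE]; apply/asboolP.
by exists (d * c); rewrite ?mulf_neq0// wE vE scalerA.
Qed.

Canonical same_line_equiv : equiv_rel nonzero_vectors :=
  EquivRel same_line same_line_refl same_line_sym same_line_trans.

Definition real_projective_space : topologicalType :=
  quotient_topology {eq_quot same_line_equiv}%qT.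

End Projective.

(* Main.v *)
Require Import Defs.
From mathcomp Require Import all_boot all_order all_algebra.
From mathcomp Require Import all_classical all_reals all_analysis.
From mathcomp Require Import ring lra.
Set Implicit Arguments.
Unset Strict Implicit.
Unset Printing Implicit Defensive.
Import Order.TTheory GRing.Theory Num.Theory numFieldNormedType.Exports.
Local Open Scope classical_set_scope.
Local Open Scope ring_scope.

(** Both homeomorphisms are continuous bijections from a compact space to a
    Hausdorff space ([compact_bijection_homeomorphic]).

    A point of Hom(C_5, K_m) is a family [p_0, ..., p_4] of probability vectors
    on the m colours such that cyclically consecutive vectors have disjoint
    supports ([pentagon_carrierP]).  Put
    [x = (p_0 + p_3) / 2 - p_4] and [y = (p_1 + p_3) / 2 - p_2].
    The disjointness conditions make the terms in these formulas the positive
    and negative parts of [x] and [y], and [p_3 / 2] the minimum of their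
    positive parts.  So the complex is the set of pairs [(x, y)] of vectors of
    coordinate sum 0 whose positive parts have total mass 1 and whose overlap,
    the sum of the minima of the positive parts, is one half ([weightsK],
    [diff_weights], [weights_carrier]).

    Identify the vectors of sum 0 with R^(m-1), and send [(x, y)] to the
    orthonormal frame [(u, v)] of its inner and outer bisector.  The pairs with
    frame [(u, v)] are those proportional to [u + t v] and [u - t v] with
    [t > 0].  As [t] runs from 0 to infinity, the pair scaled to mass 1 moves
    from [(u, u)] to [(v, - v)] and its overlap goes from 1 to 0.  It decreases
    strictly while it lies between these values ([repel_overlap]), and so it
    equals one half exactly once: the map to the Stiefel manifold is injective
    ([slide_inj]) and surjective ([slide_exists]).  This works for all m >= 1 and
    gives Hom(C_5, K_m) = V_(m-1, 2) ([hom_C5_complete_stiefel]).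

    For V_(3, 2) = RP^3, a nonzero quaternion [q] is sent to the images of [i]
    and [j] under the rotation [p |-> q p q^-1].  Two quaternions give the same
    frame exactly when they are proportional ([spin_unique]), and each frame is
    obtained because the equations [r q = q i], [s q = q j] are linear in [q]
    and have a nonzero solution ([exists_spin]). *)

(** * Compactness, subspaces and continuity *)

Lemma compact_bijection_homeomorphic (X Y : topologicalType) (f : X -> Y) :
  compact [set: X] -> hausdorff_space Y -> continuous f -> injective f ->
  (forall y, exists x, f x = y) -> homeomorphic X Y.
Proof.
move=> cX hY cf fI fS; pose g y := projT1 (cid (fS y)).
have gK : cancel g f by move=> y; rewrite /g; case: cid.
have fK : cancel f g by move=> x; apply: fI; rewrite gK.
exists f, g; split=> //; apply/continuous_closedP => C cC.
have -> : g @^-1` C = f @` C.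
  apply/seteqP; split=> [y Cy|_ [x Cx <-]]; last by rewrite /= fK.
  by exists (g y) => //; exact: gK.
apply: compact_closed => //; apply: continuous_compact.
  exact: continuous_subspaceT.
exact: subclosed_compact cC cX _.
Qed.

Lemma homeomorphic_sym (X Y : topologicalType) :
  homeomorphic X Y -> homeomorphic Y X.
Proof. by move=> [f [g [cf cg fK gK]]]; exists g, f. Qed.

(** A cluster point of the image filter in the ambient space lies in [A], and
    the open sets of the subspace are traces of ambient ones. *)
Lemma compact_set_type (X : topologicalType) (A : set X) :
  compact A -> compact [set: set_type A].
Proof.
move=> cA F FF FT.
have [|p [Ap Fp]] := cA (fmap set_val F).
  change (F (set_val @^-1` A)).
  by apply: (filterS _ FT) => x _; exact: (set_mem (valP x)).
exists (exist _ p (mem_set Ap)); split=> // B C FB [_ [[U oU <-] Up sUC]].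
have [_ [/= [b Bb <-] Ub]] : (set_val @` B) `&` U !=set0.
  apply: Fp; last by apply: open_nbhs_nbhs; split.
  change (F (set_val @^-1` (set_val @` B))).
  by apply: (filterS _ FB) => x Bx; exists x.
by exists b; split=> //; exact: sUC.
Qed.

Lemma hausdorff_set_type (X : topologicalType) (A : set X) :
  hausdorff_space X -> hausdorff_space (set_type A).
Proof.
move=> hX p q pq; apply: val_inj; apply: hX => U V pU qV.
have [x [Ux Vx]] := pq _ _ (initial_continuous pU) (initial_continuous qV).
by exists (set_val x).
Qed.

Lemma continuous_to_set_type (X Y : topologicalType) (A : set Y)
    (f : X -> set_type A) :
  continuous (fun x => set_val (f x)) -> continuous f.
Proof. exact: continuous_comp_initial. Qed.

Lemma hausdorff_matrix (R : realType) m n : hausdorff_space 'M[R]_(m, n).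
Proof. exact: norm_hausdorff. Qed.

Lemma closed_forall (X : topologicalType) (I : Type) (A : I -> set X) :
  (forall i, closed (A i)) -> closed [set x | forall i, A i x].
Proof.
move=> cA; rewrite [X in closed X](_ : _ = \bigcap_i A i).
  by apply: closed_bigI => i _; exact: cA.
by apply/seteqP; split=> [x Ax i _|x Ax i]; exact: Ax.
Qed.

Section RealContinuity.
Context (R : realType) (X : topologicalType).

Lemma continuous_sum (I : Type) (r : seq I) (P : pred I) (f : I -> X -> R) :
  (forall i, continuous (f i)) ->
  continuous (fun x => \sum_(i <- r | P i) f i x).
Proof. by move=> cf; apply: continuous_big => //; exact: add_continuous. Qed.

Lemma continuous_to_matrix m n (f : X -> 'M[R]_(m, n)) :
  (forall i j, continuous (fun x => f x i j)) -> continuous f.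
Proof.
move=> cf x; apply/cvg_mx_entourageP => E entE.
have near_ij i j : \forall y \near x, (f x i j, f y i j) \in E.
  have near_E : nbhs x [set y | E (f x i j, f y i j)].
    by have /cvg_entourageP/(_ _ entE) := cf i j x.
  by apply: (filterS _ near_E) => y; rewrite inE.
by apply: filter_forall => i; apply: filter_forall => j; exact: near_ij.
Qed.

Lemma continuous_mean_sub (f g h : X -> R) :
  continuous f -> continuous g -> continuous h ->
  continuous (fun x => (f x + g x) / 2 - h x).
Proof.
move=> cf cg ch x.
exact: (cvgB (cvgM (cvgD (cf x) (cg x)) (cvg_cst _)) (ch x)).
Qed.

End RealContinuity.

(** * The overlap of two vectors of mass 1 *)

Section Overlap.
Context (R : realFieldType) (T : finType).
Implicit Types (x y u v : T -> R).

Definition pos (r : R) : R := Num.max r 0.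

Definition mass x : R := \sum_a pos (x a).

(** For vectors of mass 1 the overlap runs from 0 (disjoint positive supports)
    to 1 (equal positive parts), so it measures how close the two positive
    parts are. *)
Definition overlap x y : R := \sum_a Num.min (pos (x a)) (pos (y a)).

Lemma pos_ge0 r : 0 <= pos r.
Proof. by rewrite le_max lexx orbT. Qed.

Lemma posE r : 0 <= r -> pos r = r.
Proof. by move=> r0; apply/max_idPl. Qed.

Lemma pos0 r : r <= 0 -> pos r = 0.
Proof. by move=> r0; apply/max_idPr. Qed.

Lemma ge_pos r : r <= pos r.
Proof. by rewrite le_max lexx. Qed.

Lemma posM c r : 0 <= c -> pos (c * r) = c * pos r.
Proof. by move=> c0; rewrite /pos maxr_pMr // mulr0. Qed.

Lemma massZ c x : 0 <= c -> mass (fun a => c * x a) = c * mass x.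
Proof.
by move=> c0; rewrite /mass mulr_sumr; apply: eq_bigr => a _; rewrite posM.
Qed.

Lemma mass_gt0 x : \sum_a x a = 0 -> (exists a, x a != 0) -> 0 < mass x.
Proof.
move=> x0 [a xa0]; rewrite lt_neqAle sumr_ge0 ?andbT => [|b _]; last first.
  exact: pos_ge0.
apply: contra_neq xa0 => /esym /psumr_eq0P => /(_ (fun b _ => pos_ge0 _)) m0.
have xle0 b : x b <= 0 by rewrite -(m0 b isT) ge_pos.
have /psumr_eq0P xE : \sum_b - x b = 0 by rewrite sumrN x0 oppr0.
apply: oppr_inj; rewrite oppr0; apply: xE => // b _; by rewrite oppr_ge0.
Qed.

Section Repel.
Variables (x y x' : T -> R) (k m : R).
Hypothesis m0 : 0 < m.
Hypothesis x'E : forall a, x' a = k * x a - m * y a.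
Hypotheses (mx : mass x = 1) (my : mass y = 1) (mx' : mass x' = 1).

(** Comes from [k * x = x' + m * y] and the subadditivity of the positive
    part.  Its sum over all points bounds [k - m], and its equality case
    locates the supports. *)
Lemma repel_pos a : k * pos (x a) <= pos (x' a) + m * pos (y a).
Proof.
have := ge_pos (x' a); have := pos_ge0 (x' a); rewrite x'E.
have := ler_wpM2l (ltW m0) (ge_pos (y a)).
have := mulr_ge0 (ltW m0) (pos_ge0 (y a)).
by case: (lerP 0 (x a)) => [/posE ->|/ltW /pos0 ->]; lra.
Qed.

Lemma repel_rate : k - m <= 1.
Proof.
have : \sum_a k * pos (x a) <= \sum_a (pos (x' a) + m * pos (y a)).
  by apply: ler_sum => a _; exact: repel_pos.
by rewrite big_split -!mulr_sumr /= -!/(mass _) mx mx' my; lra.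
Qed.

(** If the bound [k - m <= 1] is attained, then [repel_pos] is an equality at
    each point, and this excludes points where [y] is positive but [x] is
    not. *)
Lemma repel_rate_support : 1 <= k - m -> forall a, 0 < y a -> 0 < x a.
Proof.
move=> km a ya0.
have gap_ge0 b : true -> 0 <= pos (x' b) + m * pos (y b) - k * pos (x b).
  by rewrite subr_ge0 repel_pos.
have := psumr_eq0P gap_ge0; rewrite sumrB big_split -!mulr_sumr /=.
rewrite -!/(mass _) mx mx' my; have := repel_rate => ? gap0.
have {gap0} := gap0 _ a isT; rewrite (posE (ltW ya0)) => gap0.
rewrite ltNge; apply/negP => xa0; rewrite (pos0 xa0) in gap0.
have : 1 + m * 1 - k * 1 = 0 by lra.
by move/gap0; have := pos_ge0 (x' a); have := mulr_gt0 m0 ya0; lra.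
Qed.

End Repel.

(** Let [p <= q].  If [0 < p], then [p] does not grow, as [k * p - m * q] is at
    most [(k - m) * p].  If [p <= 0], then [l * p' + m * q'] is
    [(k * l - m * n) * p], which is not positive, so [p'] and [q'] are not both
    positive. *)
Lemma repel_term (k l m n p q p' q' : R) :
  0 < k -> 0 < l -> 0 < m -> 0 < n -> m * n < k * l ->
  k - m <= 1 -> l - n <= 1 -> p' = k * p - m * q -> q' = l * q - n * p ->
  Num.min (pos p') (pos q') <= Num.min (pos p) (pos q).
Proof.
wlog pq : k l m n p q p' q' / p <= q => [wlog_pq|].
  move=> *; case: (leP p q) => [pq|/ltW pq]; first exact: (wlog_pq k l m n).
  by rewrite minC [leRHS]minC; apply: (wlog_pq l k n m) => //; lra.
move=> k0 l0 m0 n0 mnkl km ln p'E q'E.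
have [p_gt0|p_le0] := ltP 0 p.
  rewrite [pos p]posE ?[pos q]posE ?[leRHS]min_l; [|lra..].
  rewrite ge_min ge_max (ltW p_gt0) andbT p'E.
  have := ler_wpM2l (ltW m0) pq.
  by have := ler_wpM2r (ltW p_gt0) km; lra.
suff : (p' <= 0) || (q' <= 0).
  move=> z; apply: (@le_trans _ _ 0); last by rewrite le_min !pos_ge0.
  by case/orP: z => /pos0 ->; rewrite ge_min lexx ?orbT.
rewrite -implyNb -ltNge; apply/implyP => p'0.
rewrite leNgt; apply/negP => q'0.
have : 0 < l * p' + m * q' by rewrite addr_gt0 ?mulr_gt0.
have -> : l * p' + m * q' = (k * l - m * n) * p by rewrite p'E q'E; ring.
by rewrite pmulr_rgt0 ?subr_gt0 // ltNge p_le0.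
Qed.

(** Pushing two vectors of mass 1 apart decreases their overlap.  No term grows
    by [repel_term].  If no term shrinks, a point common to both supports has
    equal values and forces [k - m = 1]; then the support of [y] lies in that
    of [x], so the two vectors agree on it and their overlap was already 1. *)
Lemma repel_overlap x y x' y' (k l m n : R) :
  0 < k -> 0 < l -> 0 < m -> 0 < n -> m * n < k * l ->
  (forall a, x' a = k * x a - m * y a) ->
  (forall a, y' a = l * y a - n * x a) ->
  mass x = 1 -> mass y = 1 -> mass x' = 1 -> mass y' = 1 ->
  0 < overlap x y < 1 -> overlap x' y' < overlap x y.
Proof.
move=> k0 l0 m0 n0 mnkl x'E y'E mx my mx' my' /andP[xy0 xy1].
have km := repel_rate m0 x'E mx my mx'.
have ln := repel_rate n0 y'E my mx my'.
have termwise a :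
    Num.min (pos (x' a)) (pos (y' a)) <= Num.min (pos (x a)) (pos (y a)).
  exact: (repel_term k0 l0 m0 n0 mnkl km ln (x'E a) (y'E a)).
rewrite lt_neqAle ler_sum ?andbT //.
apply: contraTneq xy1 => eq_xy.
have gap_ge0 a : true -> 0 <= Num.min (pos (x a)) (pos (y a)) -
    Num.min (pos (x' a)) (pos (y' a)).
  by rewrite subr_ge0.
have same a :
    Num.min (pos (x' a)) (pos (y' a)) = Num.min (pos (x a)) (pos (y a)).
  have := psumr_eq0P gap_ge0; rewrite sumrB -!/(overlap _ _) eq_xy subrr.
  by move=> /(_ erefl a isT) /eqP; rewrite subr_eq0 => /eqP.
have common a : 0 < x a -> 0 < y a -> x a = y a /\ 1 <= k - m.
  move=> xa ya; have := same a.
  rewrite (posE (ltW xa)) (posE (ltW ya)) => sa.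
  have m_gt0 : 0 < Num.min (x a) (y a) by rewrite lt_min xa.
  have : Num.min (x a) (y a) <= pos (x' a) by rewrite -sa ge_min lexx.
  have : Num.min (x a) (y a) <= pos (y' a) by rewrite -sa ge_min lexx orbT.
  rewrite /pos !le_max ![_ <= 0]leNgt m_gt0 /= !orbF x'E y'E.
  case: (ltgtP (x a) (y a)) => [xy|yx|<-] ym xm.
  - by have := ltr_pM2l m0 (x a) (y a); have := ler_wpM2r (ltW xa) km; lra.
  - by have := ltr_pM2l n0 (y a) (x a); have := ler_wpM2r (ltW ya) ln; lra.
  - split=> //; rewrite -(ler_pM2r xa); lra.
have [a xa ya] : exists2 a, 0 < x a & 0 < y a.
  have [a /andP[xa ya]|none] := pickP (fun a => (0 < x a) && (0 < y a)).
    by exists a.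
  move: xy0; rewrite /overlap big1 ?ltxx // => a _.
  have /negbT := none a; rewrite negb_and -!leNgt.
  by case/orP => /pos0 ->; [rewrite min_l|rewrite min_r] => //; exact: pos_ge0.
have [_ km1] := common a xa ya.
rewrite -leNgt -my; apply: ler_sum => b _.
rewrite le_min lexx andbT.
have [yb|/pos0 ->] := ltP 0 (y b); last exact: pos_ge0.
have xb := repel_rate_support m0 x'E mx my mx' km1 yb.
by have [-> _] := common b xb yb.
Qed.

(** Along the path of pairs [u + t v], [u - t v], scaled to mass 1, a larger
    [t] means that the two vectors are further apart. *)
Lemma slide_overlap u v x y x' y' (alpha beta alpha' beta' t t' : R) :
  0 < alpha -> 0 < beta -> 0 < alpha' -> 0 < beta' -> 0 < t -> t < t' ->
  (forall a, x a = alpha * (u a + t * v a)) ->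
  (forall a, y a = beta * (u a - t * v a)) ->
  (forall a, x' a = alpha' * (u a + t' * v a)) ->
  (forall a, y' a = beta' * (u a - t' * v a)) ->
  mass x = 1 -> mass y = 1 -> mass x' = 1 -> mass y' = 1 ->
  0 < overlap x y < 1 -> overlap x' y' < overlap x y.
Proof.
move=> al be al' be' t0 tt' xE yE x'E y'E.
(* The coefficients express the new pair through the old one, by
   [u + t' v = ((t' + t) (u + t v) - (t' - t) (u - t v)) / (2 t)]. *)
have t2 : 0 < 2 * t by lra.
have sum0 : 0 < t' + t by lra.
have dif0 : 0 < t' - t by lra.
have al0 : alpha != 0 by rewrite gt_eqF.
have be0 : beta != 0 by rewrite gt_eqF.
have tn0 : t != 0 by rewrite gt_eqF.
apply: (@repel_overlap _ _ _ _ (alpha' / (2 * t * alpha) * (t' + t))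
  (beta' / (2 * t * beta) * (t' + t)) (alpha' / (2 * t * beta) * (t' - t))
  (beta' / (2 * t * alpha) * (t' - t))).
1-4: by rewrite !mulr_gt0 // invr_gt0 mulr_gt0.
- rewrite [ltLHS]mulrACA [ltRHS]mulrACA.
  have -> : alpha' / (2 * t * beta) * (beta' / (2 * t * alpha)) =
      alpha' / (2 * t * alpha) * (beta' / (2 * t * beta)).
    by rewrite !invfM; ring.
  rewrite ltr_pM2l; last by rewrite !mulr_gt0 // invr_gt0 mulr_gt0.
  by rewrite -!expr2 ltr_sqr ?nnegrE; lra.
- by move=> a; rewrite x'E xE yE; field; rewrite al0 be0 tn0.
- by move=> a; rewrite y'E xE yE; field; rewrite al0 be0 tn0.
Qed.

(** Strict monotonicity makes the overlap determine the position on the path. *)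
Lemma slide_inj u v x y x' y' (alpha beta alpha' beta' t t' : R) :
  0 < alpha -> 0 < beta -> 0 < alpha' -> 0 < beta' -> 0 < t -> 0 < t' ->
  (forall a, x a = alpha * (u a + t * v a)) ->
  (forall a, y a = beta * (u a - t * v a)) ->
  (forall a, x' a = alpha' * (u a + t' * v a)) ->
  (forall a, y' a = beta' * (u a - t' * v a)) ->
  mass x = 1 -> mass y = 1 -> mass x' = 1 -> mass y' = 1 ->
  0 < overlap x y < 1 -> overlap x' y' = overlap x y -> x =1 x' /\ y =1 y'.
Proof.
move=> al be al' be' t0 t'0 xE yE x'E y'E mx my mx' my' o01 oE.
have [tt'|t't|tt'] := ltgtP t t'.
- have := slide_overlap al be al' be' t0 tt' xE yE x'E y'E mx my mx' my' o01.
  by rewrite oE ltxx.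
- rewrite -oE in o01.
  have := slide_overlap al' be' al be t'0 t't x'E y'E xE yE mx' my' mx my o01.
  by rewrite oE ltxx.
subst t'.
(* Positive multiples of one vector that have mass 1 are equal. *)
have prop (z z' w : T -> R) (c c' : R) : 0 < c -> 0 < c' ->
    (forall a, z a = c * w a) -> (forall a, z' a = c' * w a) ->
    mass z = 1 -> mass z' = 1 -> z =1 z'.
  move=> c0 c'0 zE z'E mz mz' a; rewrite zE z'E.
  have massE b f : 0 < b -> (forall a, f a = b * w a) -> mass f = b * mass w.
    move=> b0 fE; rewrite -massZ ?ltW //.
    by apply: eq_bigr => d _; rewrite fE.
  rewrite (massE _ _ c0 zE) in mz; rewrite (massE _ _ c'0 z'E) in mz'.
  have w0 : mass w != 0.
    by apply: contra_eq_neq mz => ->; rewrite mulr0 eq_sym oner_neq0.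
  by congr (_ * _); apply: (mulIf w0); rewrite mz mz'.
split; first exact: (prop _ _ _ _ _ al al' xE x'E).
exact: (prop _ _ _ _ _ be be' yE y'E).
Qed.

End Overlap.

Section OverlapContinuity.
Context (R : realType) (X : topologicalType).

Lemma continuous_pos (f : X -> R) :
  continuous f -> continuous (fun x => pos (f x)).
Proof.
by move=> cf x; apply: continuous_max; [exact: cf|exact: cst_continuous].
Qed.

Lemma continuous_mass (T : finType) (f : X -> T -> R) :
  (forall a, continuous (fun x => f x a)) -> continuous (fun x => mass (f x)).
Proof. by move=> cf; apply: continuous_sum => a; exact: continuous_pos. Qed.

Lemma continuous_overlap (T : finType) (f g : X -> T -> R) :
  (forall a, continuous (fun x => f x a)) ->
  (forall a, continuous (fun x => g x a)) ->
  continuous (fun x => overlap (f x) (g x)).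
Proof.
move=> cf cg; apply: continuous_sum => a x.
apply: (@continuous_min R X (fun x => pos (f x a)) (fun x => pos (g x a)));
  exact: continuous_pos.
Qed.

End OverlapContinuity.

Section Existence.
Context (R : realType) (T : finType).
Implicit Types (u v : T -> R).

Definition unit_mass u : T -> R := fun a => (mass u)^-1 * u a.

Lemma mass_unit_mass u : 0 < mass u -> mass (unit_mass u) = 1.
Proof. by move=> u0; rewrite massZ ?mulVf ?gt_eqF // invr_ge0 ltW. Qed.

Lemma overlapxx u : overlap u u = mass u.
Proof. by apply: eq_bigr => a _; rewrite minxx. Qed.

Lemma continuous_unit_mass (X : topologicalType) (f : X -> T -> R) :
  (forall a, continuous (fun x => f x a)) -> (forall x, 0 < mass (f x)) ->
  forall a, continuous (fun x => unit_mass (f x) a).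
Proof.
move=> cf f0 a x; apply: cvgM; last exact: cf.
by apply: cvgV; [rewrite gt_eqF|exact: continuous_mass].
Qed.

(** The intermediate value theorem, for the overlap of two vectors that move
    from [u] to [v] and from [u] to [- v]: it starts at 1, where they coincide,
    and ends at 0, where they are opposite. *)
Lemma slide_exists u v (c : R) :
  \sum_a u a = 0 -> \sum_a v a = 0 ->
  (forall p q, (forall a, p * u a + q * v a = 0) -> p = 0 /\ q = 0) ->
  0 < c < 1 ->
  exists t alpha beta, [/\ 0 < t, 0 < alpha, 0 < beta &
    let x a := alpha * (u a + t * v a) in
    let y a := beta * (u a - t * v a) in
    [/\ mass x = 1, mass y = 1 & overlap x y = c]].
Proof.
move=> u0 v0 free /andP[c0 c1].
(* [e] is 1 on the path towards [v] and -1 on the path towards [- v]. *)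
pose X e s a := (1 - s) * u a + e * s * v a.
have X_gt0 e s : e != 0 -> 0 < mass (X e s).
  move=> e0; apply: mass_gt0.
    by rewrite big_split -!mulr_sumr u0 v0 /= !mulr0 addr0.
  apply: contrapT => nex.
  have [|] := free (1 - s) (e * s).
    by move=> a; apply: contrapT => /eqP na; apply: nex; exists a.
  move=> s1 /eqP; rewrite mulf_eq0 (negPf e0) /= => /eqP s0; lra.
have one0 : (1 : R) != 0 by rewrite oner_neq0.
have mone0 : (-1 : R) != 0 by rewrite oppr_eq0.
pose F s := overlap (unit_mass (X 1 s)) (unit_mass (X (-1) s)).
have cX e a : continuous (fun s => X e s a).
  move=> s; apply: cvgD; apply: cvgM; try exact: cvg_cst.
    by apply: cvgB; [exact: cvg_cst|exact: cvg_id].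
  by apply: cvgM; [exact: cvg_cst|exact: cvg_id].
have cF : continuous F.
  apply: continuous_overlap; apply: continuous_unit_mass => // s;
    exact: X_gt0.
have F0 : F 0 = 1.
  have XE : X 1 0 = u by apply/funext => a; rewrite /X; ring.
  have X'E : X (-1) 0 = u by apply/funext => a; rewrite /X; ring.
  by rewrite /F XE X'E overlapxx mass_unit_mass // -XE X_gt0.
have F1 : F 1 = 0.
  rewrite /F /overlap big1 // => a _.
  have X1 : X 1 1 a = v a by rewrite /X; ring.
  have X'1 : X (-1) 1 a = - v a by rewrite /X; ring.
  have i0 e : e != 0 -> 0 <= (mass (X e 1))^-1.
    by move=> e0; rewrite invr_ge0 ltW ?X_gt0.
  rewrite /unit_mass X1 X'1 mulrN.
  have [va|va] := lerP 0 (v a).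
    by rewrite [pos (- _)]pos0 ?min_r ?pos_ge0 ?oppr_le0 ?mulr_ge0 ?i0.
  by rewrite pos0 ?min_l ?pos_ge0 ?mulr_ge0_le0 ?i0 // ltW.
have [|s] := @IVT R F 0 1 c ler01 (continuous_subspaceT cF).
  by rewrite F0 F1 min_r ?max_l ?ler01 // !ltW.
rewrite in_itv /= => /andP[]; rewrite le_eqVlt => /predU1P[<-|s0].
  by rewrite F0 => _ cE; rewrite -cE ltxx in c1.
rewrite le_eqVlt => /predU1P[->|s1 Fs].
  by rewrite F1 => cE; rewrite -cE ltxx in c0.
have s1' : 0 < 1 - s by rewrite subr_gt0.
have s1n : 1 - s != 0 by rewrite gt_eqF.
have m0 := X_gt0 1 s one0; have m0' := X_gt0 (-1) s mone0.
exists (s / (1 - s)), ((mass (X 1 s))^-1 * (1 - s)),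
  ((mass (X (-1) s))^-1 * (1 - s)).
have xE : unit_mass (X 1 s) = fun a =>
    (mass (X 1 s))^-1 * (1 - s) * (u a + s / (1 - s) * v a).
  apply/funext => a; rewrite /unit_mass -mulrA; congr (_ * _).
  by rewrite /X; field.
have yE : unit_mass (X (-1) s) = fun a =>
    (mass (X (-1) s))^-1 * (1 - s) * (u a - s / (1 - s) * v a).
  apply/funext => a; rewrite /unit_mass -mulrA; congr (_ * _).
  by rewrite /X; field.
split; [by rewrite divr_gt0|by rewrite mulr_gt0 ?invr_gt0..|].
by rewrite /= -xE -yE !mass_unit_mass.
Qed.

End Existence.

(** * Vectors of sum zero and frames of bisectors *)

Section ZeroSum.
Context (R : realType) (n : nat).
Implicit Types (x : 'I_n.+1 -> R) (w : 'rV[R]_n).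

Definition drop_coord x : 'rV[R]_n := \row_j x (lift ord0 j).

(** [balance] and [drop_coord] identify ['rV[R]_n] with the hyperplane of
    vectors of sum 0 in [n.+1] coordinates. *)
Definition balance w (a : 'I_n.+1) : R :=
  if unlift ord0 a is Some j then w 0 j else - \sum_j w 0 j.

Lemma balanceK : cancel balance drop_coord.
Proof. by move=> w; apply/rowP => j; rewrite mxE /balance liftK. Qed.

Lemma sum_balance w : \sum_a balance w a = 0.
Proof.
rewrite big_ord_recl /balance unlift_none.
by rewrite [X in _ + X](eq_bigr (w 0)) ?addNr // => j _; rewrite liftK.
Qed.

Lemma drop_coordK x : \sum_a x a = 0 -> balance (drop_coord x) =1 x.
Proof.
move=> x0 a; rewrite /balance; case: unliftP => [j ->|->]; first by rewrite mxE.
rewrite big_ord_recl in x0; under eq_bigr do rewrite mxE.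
by move/eqP: x0; rewrite addr_eq0 => /eqP ->.
Qed.

Lemma balanceD w w' a : balance (w + w') a = balance w a + balance w' a.
Proof.
rewrite /balance; case: unliftP => [j _|_]; first by rewrite mxE.
by under eq_bigr do rewrite mxE; rewrite big_split opprD.
Qed.

Lemma balanceZ c w a : balance (c *: w) a = c * balance w a.
Proof.
rewrite /balance; case: unliftP => [j _|_]; first by rewrite mxE.
by under eq_bigr do rewrite mxE; rewrite -mulr_sumr mulrN.
Qed.

End ZeroSum.

Section Frames.
Context (R : realType) (n : nat).
Implicit Types (u v w x y : 'rV[R]_n) (c : R).

Lemma dotC u v : dot u v = dot v u.
Proof. by apply: eq_bigr => j _; rewrite mulrC. Qed.

Lemma dotDl u v w : dot (u + v) w = dot u w + dot v w.
Proof. by rewrite -big_split; apply: eq_bigr => j _; rewrite mxE mulrDl. Qed.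

Lemma dotZl c u v : dot (c *: u) v = c * dot u v.
Proof. by rewrite mulr_sumr; apply: eq_bigr => j _; rewrite mxE mulrA. Qed.

Lemma dotDr u v w : dot w (u + v) = dot w u + dot w v.
Proof. by rewrite dotC dotDl !(dotC w). Qed.

Lemma dotZr c u v : dot u (c *: v) = c * dot u v.
Proof. by rewrite dotC dotZl dotC. Qed.

Lemma dot_ge0 u : 0 <= dot u u.
Proof. by apply: sumr_ge0 => j _; rewrite -expr2 sqr_ge0. Qed.

Lemma dot_eq0 u : (dot u u == 0) = (u == 0).
Proof.
apply/eqP/eqP => [/psumr_eq0P u0|->]; last first.
  by apply: big1 => j _; rewrite mxE mul0r.
apply/rowP => j; rewrite mxE; apply/eqP; rewrite -sqrf_eq0 expr2.
by rewrite u0 // => i _; rewrite -expr2 sqr_ge0.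
Qed.

Definition enorm u : R := Num.sqrt (dot u u).

Lemma enorm_sqr u : enorm u ^+ 2 = dot u u.
Proof. by rewrite sqr_sqrtr ?dot_ge0. Qed.

Lemma enorm_gt0 u : (0 < enorm u) = (u != 0).
Proof. by rewrite sqrtr_gt0 lt_neqAle dot_ge0 andbT eq_sym dot_eq0. Qed.

Lemma enormZ c u : 0 <= c -> enorm (c *: u) = c * enorm u.
Proof.
move=> c0; rewrite /enorm dotZl dotZr mulrA -expr2 sqrtrM ?sqr_ge0 //.
by rewrite sqrtr_sqr ger0_norm.
Qed.

Definition normalize u : 'rV[R]_n := (enorm u)^-1 *: u.

Lemma normalizeZ c u : 0 < c -> normalize (c *: u) = normalize u.
Proof.
move=> c0; rewrite /normalize enormZ ?ltW // scalerA invfM mulrAC.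
rewrite mulVf ?mul1r //.
by rewrite gt_eqF.
Qed.

Lemma normalize_unit u : dot u u = 1 -> normalize u = u.
Proof. by move=> u1; rewrite /normalize /enorm u1 sqrtr1 invr1 scale1r. Qed.

Lemma enormK u : u != 0 -> enorm u *: normalize u = u.
Proof. by move=> u0; rewrite scalerA divff ?scale1r // gt_eqF ?enorm_gt0. Qed.

(** Built from copies of [x] and [y] of equal length, the sum and the
    difference are orthogonal, like the diagonals of a rhombus. *)
Definition inner_bisector x y : 'rV[R]_n := enorm y *: x + enorm x *: y.

Definition outer_bisector x y : 'rV[R]_n := enorm y *: x - enorm x *: y.

Lemma dot_bisectors x y : dot (inner_bisector x y) (outer_bisector x y) = 0.
Proof.
rewrite /inner_bisector /outer_bisector -scaleNr !(dotDl, dotDr, dotZl, dotZr).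
by rewrite (dotC y x) -!enorm_sqr; ring.
Qed.

Definition frame u v : 'M[R]_(2, n) :=
  \matrix_(i, j) (if i == 0 then u else v) 0 j.

Lemma row_frame0 u v : row 0 (frame u v) = u.
Proof. by apply/rowP => j; rewrite !mxE. Qed.

Lemma row_frame1 u v : row 1 (frame u v) = v.
Proof. by apply/rowP => j; rewrite !mxE. Qed.

Lemma ord2_case (i : 'I_2) : i = 0 \/ i = 1.
Proof. by case: i => [[|[|//]] k2]; [left|right]; apply: val_inj. Qed.

Lemma frame_rows (A : 'M[R]_(2, n)) : frame (row 0 A) (row 1 A) = A.
Proof.
apply/row_matrixP => i.
by case: (ord2_case i) => ->; rewrite ?row_frame0 ?row_frame1.
Qed.

Lemma orthonormal2P (A : 'M[R]_(2, n)) : orthonormal_frames A <->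
  [/\ dot (row 0 A) (row 0 A) = 1, dot (row 1 A) (row 1 A) = 1 &
      dot (row 0 A) (row 1 A) = 0].
Proof.
split=> [A1|[A00 A11 A01] i j]; first by rewrite !A1.
case: (ord2_case i) => ->; case: (ord2_case j) => ->;
  by rewrite ?(A00, A11, A01) // dotC A01.
Qed.

Lemma orthonormal_frameP u v : orthonormal_frames (frame u v) <->
  [/\ dot u u = 1, dot v v = 1 & dot u v = 0].
Proof. by rewrite orthonormal2P row_frame0 row_frame1. Qed.

Lemma continuous_frame (X : topologicalType) (u v : X -> 'rV[R]_n) :
  (forall j, continuous (fun p => u p 0 j)) ->
  (forall j, continuous (fun p => v p 0 j)) ->
  continuous (fun p => frame (u p) (v p)).
Proof.
move=> cu cv; apply: continuous_to_matrix => i j.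
rewrite (_ : (fun p => _) = fun p => (if i == 0 then u p else v p) 0 j).
  by case: (i == 0); [exact: cu|exact: cv].
by apply/funext => p; rewrite mxE.
Qed.

Definition bisector_frame x y : 'M[R]_(2, n) :=
  frame (normalize (inner_bisector x y)) (normalize (outer_bisector x y)).

Lemma dot_normalize u : u != 0 -> dot (normalize u) (normalize u) = 1.
Proof.
rewrite -enorm_gt0 => u0; rewrite dotZl dotZr -enorm_sqr expr2 mulrA.
by rewrite -invfM mulVf // mulf_neq0 // gt_eqF.
Qed.

Lemma bisector_frame_orthonormal x y :
  inner_bisector x y != 0 -> outer_bisector x y != 0 ->
  orthonormal_frames (bisector_frame x y).
Proof.
move=> i0 o0; apply/orthonormal_frameP; rewrite !dot_normalize //; split=> //.
by rewrite dotZl dotZr dot_bisectors !mulr0.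
Qed.

(** Half the sum and half the difference of the bisectors are [enorm y *: x]
    and [enorm x *: y], so a pair is recovered from its frame up to a
    parameter [t] and two scales. *)
Lemma bisector_frame_coords x y : x != 0 -> y != 0 ->
  inner_bisector x y != 0 -> outer_bisector x y != 0 ->
  let u := row 0 (bisector_frame x y) in
  let v := row 1 (bisector_frame x y) in
  exists t alpha beta, [/\ 0 < t, 0 < alpha, 0 < beta,
    x = alpha *: (u + t *: v) & y = beta *: (u - t *: v)].
Proof.
move=> x0 y0 i0 o0 u v.
have uK : enorm (inner_bisector x y) *: u = inner_bisector x y.
  by rewrite /u row_frame0 enormK.
have vK : enorm (outer_bisector x y) *: v = outer_bisector x y.
  by rewrite /v row_frame1 enormK.
move: x0 y0 i0 o0; rewrite -!enorm_gt0 => x0 y0 i0 o0.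
set ni := enorm (inner_bisector x y) in uK i0.
set no := enorm (outer_bisector x y) in vK o0.
exists (no / ni), (ni / (2 * enorm y)), (ni / (2 * enorm x)).
have nz : [/\ ni != 0, enorm x != 0 & enorm y != 0] by rewrite !gt_eqF.
have [ni0 nx0 ny0] := nz.
split; try by rewrite divr_gt0 ?mulr_gt0.
- rewrite scalerDr scalerA (_ : ni / _ * _ = (2 * enorm y)^-1 * no); last first.
    by field; rewrite ni0 ny0.
  rewrite [ni / _]mulrC -!scalerA uK vK -scalerDr.
  rewrite /inner_bisector /outer_bisector.
  by apply/rowP => j; rewrite !mxE; field.
- rewrite scalerBr scalerA (_ : ni / _ * _ = (2 * enorm x)^-1 * no); last first.
    by field; rewrite ni0 nx0.
  rewrite [ni / _]mulrC -!scalerA uK vK -scalerBr.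
  rewrite /inner_bisector /outer_bisector.
  by apply/rowP => j; rewrite !mxE; field.
Qed.

Lemma bisector_frame_slide (A : 'M[R]_(2, n)) x y (t alpha beta : R) :
  orthonormal_frames A -> 0 < t -> 0 < alpha -> 0 < beta ->
  x = alpha *: (row 0 A + t *: row 1 A) ->
  y = beta *: (row 0 A - t *: row 1 A) ->
  bisector_frame x y = A.
Proof.
move=> /orthonormal2P[A00 A11 A01] t0 al be -> ->.
set u := row 0 A in A00 A01 *; set v := row 1 A in A11 A01 *.
set r := Num.sqrt (1 + t ^+ 2).
have r0 : 0 < r by rewrite sqrtr_gt0 ltr_wpDr ?sqr_ge0.
have n1 : enorm (u + t *: v) = r.
  rewrite /enorm !(dotDl, dotDr, dotZl, dotZr) A00 A11 (dotC v) A01.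
  by congr (Num.sqrt _); ring.
have n2 : enorm (u - t *: v) = r.
  rewrite /enorm -scaleNr !(dotDl, dotDr, dotZl, dotZr) A00 A11 (dotC v) A01.
  by congr (Num.sqrt _); ring.
have iE : inner_bisector (alpha *: (u + t *: v)) (beta *: (u - t *: v)) =
    (2 * alpha * beta * r) *: u.
  rewrite /inner_bisector !enormZ ?ltW // n1 n2.
  by apply/rowP => j; rewrite !mxE; ring.
have oE : outer_bisector (alpha *: (u + t *: v)) (beta *: (u - t *: v)) =
    (2 * alpha * beta * r * t) *: v.
  rewrite /outer_bisector !enormZ ?ltW // n1 n2.
  by apply/rowP => j; rewrite !mxE; ring.
rewrite /bisector_frame iE oE !normalizeZ ?mulr_gt0 //.
by rewrite !normalize_unit // frame_rows.
Qed.

Lemma continuous_bisector_frame (X : topologicalType) (x y : X -> 'rV[R]_n) :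
  (forall j, continuous (fun p => x p 0 j)) ->
  (forall j, continuous (fun p => y p 0 j)) ->
  (forall p, inner_bisector (x p) (y p) != 0) ->
  (forall p, outer_bisector (x p) (y p) != 0) ->
  continuous (fun p => bisector_frame (x p) (y p)).
Proof.
move=> cx cy i0 o0.
have cenorm (f : X -> 'rV[R]_n) : (forall j, continuous (fun p => f p 0 j)) ->
    continuous (fun p => enorm (f p)).
  move=> cf p.
  apply: (@continuous_comp X R R (fun p => dot (f p) (f p)) Num.sqrt).
    by apply: continuous_sum => j q; apply: cvgM; exact: cf.
  exact: sqrt_continuous.
have cnormalize (f : X -> 'rV[R]_n) :
    (forall j, continuous (fun p => f p 0 j)) ->
    (forall p, f p != 0) -> forall j, continuous (fun p => normalize (f p) 0 j).
  move=> cf f0 j p; under [fun p => _]eq_fun do rewrite mxE.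
  apply: cvgM; last exact: cf.
  by apply: cvgV; [rewrite gt_eqF ?enorm_gt0|exact: cenorm].
apply: continuous_frame; apply: cnormalize => // k p.
  under [fun p => _]eq_fun do rewrite !mxE.
  by apply: cvgD; apply: cvgM; [exact: cenorm|exact: cx|exact: cenorm|exact: cy].
under [fun p => _]eq_fun do rewrite !mxE.
by apply: cvgB; apply: cvgM; [exact: cenorm|exact: cx|exact: cenorm|exact: cy].
Qed.

End Frames.

(** * Hom complexes as subspaces of a product of simplices *)

Section Carrier.
Context (R : realType) (G H : sgraph).

(** A point that lies in some cell lies in the cell spanned by its supports. *)
Lemma hom_carrierP (p : hom_ambient R G H) :
  hom_carrier p <-> (forall x, simplex (p x)) /\
    (forall u v, adj u v -> forall a b, ~~ adj a b -> p u a * p v b = 0).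
Proof.
split=> [[eta [eta0 etaE] pE]|[ps pE]].
  split=> [x|u v uv a b]; first by case: (pE x).
  apply: contraNeq; rewrite mulf_eq0 negb_or => /andP[pa pb].
  apply: (etaE u v uv).
    by apply: contraNT pa => ?; apply/eqP; case: (pE u) => _; exact.
  by apply: contraNT pb => ?; apply/eqP; case: (pE v) => _; exact.
exists (fun x => [set a | p x a != 0]%SET); first split.
- move=> x; apply/negP => /eqP eta0; case: (ps x) => _ /eqP.
  rewrite big1 1?eq_sym ?oner_eq0 // => a _; apply/eqP.
  by have := finset.in_set0 a; rewrite -eta0 inE => /negbFE.
- move=> u v uv a b; rewrite !inE => pa pb; apply/negPn/negP => nab.
  by have /eqP := pE u v uv a b nab; rewrite mulf_eq0 (negPf pa) (negPf pb).
- by move=> x; split=> // a; rewrite inE negbK => /eqP.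
Qed.

Lemma continuous_weight (x : G) (a : H) :
  continuous (fun p : hom_ambient R G H => p x a).
Proof.
move=> p; apply: (@continuous_comp (hom_ambient R G H) (coord_space R H) R
  (fun p => p x) (fun t => t a)).
  exact: (@proj_continuous G (fun=> coord_space R H) x p).
exact: (@proj_continuous H (fun=> R) a (p x)).
Qed.

Lemma compact_hom_carrier : compact (@hom_carrier R G H).
Proof.
pose box := [set p : hom_ambient R G H | forall x a, `[0, 1]%classic (p x a)].
have cbox : compact box.
  pose side (x : G) :=
    [set t : coord_space R H | forall a, `[0, 1]%classic (t a)].
  apply: (@tychonoff G (fun=> coord_space R H) side) => x.
  apply: (@tychonoff H (fun=> R) (fun=> `[0, 1]%classic)) => a.
  exact: segment_compact.
apply: (subclosed_compact _ cbox) => [|p /hom_carrierP[ps _] x a]; last first.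
  have [p0 p1] := ps x; rewrite /= in_itv /= p0 -p1 (bigD1 a) //=.
  by rewrite lerDl sumr_ge0.
rewrite [X in closed X](_ : _ = [set p | forall x, (forall a, 0 <= p x a) /\
  \sum_a p x a = 1] `&` [set p | forall u v, adj u v -> forall a b,
  ~~ adj a b -> p u a * p v b = 0]); last first.
  by apply/seteqP; split=> p /hom_carrierP.
apply: closedI.
  apply: closed_forall => x; apply: closedI.
    apply: closed_forall => a.
    apply: (@preimage_closed _ _ _ [set r : R | 0 <= r]).
      by move=> p _; exact: continuous_weight.
    exact: closed_ge.
  apply: (@preimage_closed _ _ (fun p : hom_ambient R G H => \sum_a p x a)
    [set r : R | r = 1]).
    by move=> p _; apply: continuous_sum => a; exact: continuous_weight.
  exact: closed_eq.
apply: closed_forall => u; apply: closed_forall => v; apply: closed_forall => _.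
apply: closed_forall => a; apply: closed_forall => b; apply: closed_forall => _.
apply: (@preimage_closed _ _ (fun p : hom_ambient R G H => p u a * p v b)
  [set r : R | r = 0]).
  move=> p _.
  exact: (cvgM (@continuous_weight u a p) (@continuous_weight v b p)).
exact: closed_eq.
Qed.

End Carrier.

(** * The Hom complex of the pentagon *)

Section HomC5.
Context (R : realType) (n : nat).
Let C5 := cycle_graph 5.
Let K := complete_graph n.+1.
Implicit Types (p : hom_ambient R C5 K) (x y : 'I_n.+1 -> R).

Definition c0 : C5 := @Ordinal 5 0 isT.
Definition c1 : C5 := @Ordinal 5 1 isT.
Definition c2 : C5 := @Ordinal 5 2 isT.
Definition c3 : C5 := @Ordinal 5 3 isT.
Definition c4 : C5 := @Ordinal 5 4 isT.

Lemma C5_case (P : C5 -> Prop) :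
  P c0 -> P c1 -> P c2 -> P c3 -> P c4 -> forall i, P i.
Proof.
move=> P0 P1 P2 P3 P4 i; have : i \in [:: c0; c1; c2; c3; c4].
  by case: i => [[|[|[|[|[|//]]]]] ?].
by rewrite !inE => /or4P[/eqP->|/eqP->|/eqP->|/orP[/eqP->|/eqP->]].
Qed.

(** The model of the complex: two points on the sphere of vectors of sum 0 and
    mass 1, kept at constant overlap.  Any overlap strictly between 0 and 1
    gives a homeomorphic set; one half corresponds to the weights 1/2 below. *)
Definition pair_point x y : Prop :=
  [/\ \sum_a x a = 0, \sum_a y a = 0, mass x = 1, mass y = 1 &
      overlap x y = 2^-1].

(** The independent pairs of the pentagon are the edges of the complementary
    pentagon [c0 c3 c1 c4 c2].  Place its vertices in the plane, in this cyclic
    order, on the rays through (1/2, 0), (1/2, 1/2), (0, 1/2), (-1, 0) and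
    (0, -1): the weights at a colour [a] become a point of the plane, with
    coordinates [diff04 p a] and [diff12 p a], and as only two neighbouring rays
    carry weight, [weights] recovers them from the cone that contains the
    point. *)
Definition diff04 p : 'I_n.+1 -> R := fun a => (p c0 a + p c3 a) / 2 - p c4 a.
Definition diff12 p : 'I_n.+1 -> R := fun a => (p c1 a + p c3 a) / 2 - p c2 a.

Definition weights x y : hom_ambient R C5 K := fun i a =>
  let m := Num.min (pos (x a)) (pos (y a)) in
  match val i with
  | 0%N => 2 * (pos (x a) - m)
  | 1%N => 2 * (pos (y a) - m)
  | 2%N => pos (- y a)
  | 3%N => 2 * m
  | _ => pos (- x a)
  end.

Lemma pentagon_carrierP p : hom_carrier p <-> (forall i, simplex (p i)) /\
  forall a, [/\ p c0 a * p c1 a = 0, p c1 a * p c2 a = 0, p c2 a * p c3 a = 0,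
    p c3 a * p c4 a = 0 & p c4 a * p c0 a = 0].
Proof.
split=> /[dup] [/hom_carrierP[ps pE] _|[ps pE] _].
  by split=> // a; split; apply: pE => //; rewrite /= /complete_adj eqxx.
apply/hom_carrierP; split=> // u v uv a b.
rewrite /= /complete_adj negbK => /eqP <-; move: u v uv.
have [e0 e1 e2 e3 e4] := pE a.
by apply: C5_case; apply: C5_case => // _; rewrite // mulrC.
Qed.

Lemma pentagon_weights (q0 q1 q2 q3 q4 : R) :
  0 <= q0 -> 0 <= q1 -> 0 <= q2 -> 0 <= q3 -> 0 <= q4 ->
  q0 * q1 = 0 -> q1 * q2 = 0 -> q2 * q3 = 0 -> q3 * q4 = 0 -> q4 * q0 = 0 ->
  let x := (q0 + q3) / 2 - q4 in let y := (q1 + q3) / 2 - q2 in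
  [/\ pos x = (q0 + q3) / 2, pos y = (q1 + q3) / 2, pos (- x) = q4,
      pos (- y) = q2 & Num.min (pos x) (pos y) = q3 / 2].
Proof.
move=> h0 h1 h2 h3 h4 e01 e12 e23 e34 e40 x y.
have split_pos (r s : R) : 0 <= r -> 0 <= s -> r * s = 0 ->
    pos (r - s) = r /\ pos (- (r - s)) = s.
  move=> r0 s0 /eqP; rewrite mulf_eq0 => /orP[/eqP->|/eqP->].
    by rewrite sub0r opprK pos0 ?oppr_le0 // posE.
  by rewrite subr0 posE // pos0 ?oppr_le0.
have [|||xp xn] := split_pos ((q0 + q3) / 2) q4.
- by rewrite divr_ge0 ?addr_ge0.
- by [].
- by rewrite mulrAC mulrDl e34 [q0 * _]mulrC e40 addr0 mul0r.
have [|||yp yn] := split_pos ((q1 + q3) / 2) q2.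
- by rewrite divr_ge0 ?addr_ge0.
- by [].
- by rewrite mulrAC mulrDl e12 [q3 * _]mulrC e23 addr0 mul0r.
rewrite xp yp; split=> //.
have /eqP := e01; rewrite mulf_eq0 => /orP[/eqP->|/eqP->]; rewrite add0r.
  by rewrite min_l // ler_pM2r ?invr_gt0 // lerDr.
by rewrite min_r // ler_pM2r ?invr_gt0 // lerDr.
Qed.

Lemma pos_diffs p : hom_carrier p -> forall a,
  [/\ pos (diff04 p a) = (p c0 a + p c3 a) / 2,
      pos (diff12 p a) = (p c1 a + p c3 a) / 2,
      pos (- diff04 p a) = p c4 a, pos (- diff12 p a) = p c2 a &
      Num.min (pos (diff04 p a)) (pos (diff12 p a)) = p c3 a / 2].
Proof.
move=> /pentagon_carrierP[ps pE] a; have [e0 e1 e2 e3 e4] := pE a.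
have p0 i : 0 <= p i a by case: (ps i).
exact: (pentagon_weights (p0 c0) (p0 c1) (p0 c2) (p0 c3) (p0 c4)).
Qed.

Lemma pair_point_diffs p : hom_carrier p -> pair_point (diff04 p) (diff12 p).
Proof.
move=> cp; have W := pos_diffs cp; case/pentagon_carrierP: cp => ps _.
have p1 i : \sum_a p i a = 1 by case: (ps i).
split.
- by rewrite sumrB -mulr_suml big_split /= !p1; lra.
- by rewrite sumrB -mulr_suml big_split /= !p1; lra.
- rewrite /mass (eq_bigr (fun a => (p c0 a + p c3 a) / 2)).
    by rewrite -mulr_suml big_split /= !p1; lra.
  by move=> a _; case: (W a).
- rewrite /mass (eq_bigr (fun a => (p c1 a + p c3 a) / 2)).
    by rewrite -mulr_suml big_split /= !p1; lra.
  by move=> a _; case: (W a).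
- rewrite /overlap (eq_bigr (fun a => p c3 a / 2)).
    by rewrite -mulr_suml p1; lra.
  by move=> a _; case: (W a).
Qed.

Lemma weightsK p : hom_carrier p -> weights (diff04 p) (diff12 p) = p.
Proof.
move=> cp; apply/funext => i; apply/funext => a; move: i.
have [x y x' y' m] := pos_diffs cp a.
by apply: C5_case; rewrite /weights /= ?m ?x ?y ?x' ?y' //; field.
Qed.

Lemma pos_subN (r : R) : pos r - pos (- r) = r.
Proof.
have [r0|/ltW r0] := lerP 0 r.
  by rewrite posE // pos0 ?oppr_le0 // subr0.
by rewrite pos0 // posE ?oppr_ge0 // sub0r opprK.
Qed.

Lemma mass_opp x : \sum_a x a = 0 -> mass (fun a => - x a) = mass x.
Proof.
move=> x0; apply/esym/eqP; rewrite -subr_eq0 -sumrB; apply/eqP.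
rewrite -[RHS]x0.
by apply: eq_bigr => a _; exact: pos_subN.
Qed.

Lemma pos_mulN (r : R) : pos r * pos (- r) = 0.
Proof.
have [r0|/ltW r0] := lerP 0 r.
  by rewrite [pos (- r)]pos0 ?oppr_le0 // mulr0.
by rewrite pos0 // mul0r.
Qed.

Lemma diff_weights x y :
  diff04 (weights x y) =1 x /\ diff12 (weights x y) =1 y.
Proof.
by split=> a; rewrite /diff04 /diff12 /weights /= -[RHS]pos_subN;
  congr (_ - _); field.
Qed.

Lemma weights_carrier x y : pair_point x y -> hom_carrier (weights x y).
Proof.
move=> [x0 y0 mx my oxy]; apply/pentagon_carrierP.
have below a : Num.min (pos (x a)) (pos (y a)) <= pos (x a) /\
    Num.min (pos (x a)) (pos (y a)) <= pos (y a) by rewrite !ge_min !lexx orbT.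
split; last first.
  move=> a; rewrite /weights /=.
  set px := pos (x a); set py := pos (y a); set m := Num.min px py.
  have px_nx : px * pos (- x a) = 0 := pos_mulN (x a).
  have py_ny : py * pos (- y a) = 0 := pos_mulN (y a).
  have [m_px m_py] := below a.
  have m_nx : m * pos (- x a) = 0.
    apply/le_anti; rewrite mulr_ge0 ?pos_ge0 ?le_min ?pos_ge0 // andbT.
    by rewrite -px_nx ler_wpM2r ?pos_ge0.
  have m_ny : m * pos (- y a) = 0.
    apply/le_anti; rewrite mulr_ge0 ?pos_ge0 ?le_min ?pos_ge0 // andbT.
    by rewrite -py_ny ler_wpM2r ?pos_ge0.
  have xy : (px - m) * (py - m) = 0.
    by rewrite /m; case: (leP px py) => _; rewrite subrr ?mul0r ?mulr0.
  by split; [rewrite mulrACA xy mulr0|ring: py_ny m_ny|ring: m_ny|ring: m_nx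
    |ring: px_nx m_nx].
have weights_ge0 i a : 0 <= weights x y i a.
  have [mx_le my_le] := below a; move: i.
  by apply: C5_case; rewrite /weights /= ?pos_ge0 // mulr_ge0 // ?subr_ge0 //
    le_min !pos_ge0.
apply: C5_case; (split=> [a|]; first exact: weights_ge0); rewrite /weights /=.
- by rewrite -mulr_sumr sumrB -!/(mass _) -!/(overlap _ _) mx oxy; field.
- by rewrite -mulr_sumr sumrB -!/(mass _) -!/(overlap _ _) my oxy; field.
- by rewrite -[LHS]/(mass (fun a => - y a)) mass_opp.
- by rewrite -mulr_sumr -!/(overlap _ _) oxy; field.
- by rewrite -[LHS]/(mass (fun a => - x a)) mass_opp.
Qed.

(** A vanishing bisector would make [x] and [y] proportional.  With a negative
    factor their positive supports are disjoint and the overlap is 0; a positive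
    factor is 1, because both masses are 1, and then the overlap is 1. *)
Lemma pair_point_neq0 x y : pair_point x y ->
  let X := drop_coord x in let Y := drop_coord y in
  [/\ X != 0, Y != 0, inner_bisector X Y != 0 & outer_bisector X Y != 0].
Proof.
move=> [x0 y0 mx my oxy] X Y.
have neq0 z : \sum_a z a = 0 -> mass z = 1 -> drop_coord z != 0.
  move=> z0 mz; apply: contra_eq_neq mz => dz.
  rewrite /mass big1 1?eq_sym ?oner_eq0 // => a _.
  by rewrite -(drop_coordK z0) dz -(scale0r 0) balanceZ mul0r pos0.
have X0 : X != 0 by exact: neq0.
have Y0 : Y != 0 by exact: neq0.
have nX : 0 < enorm X by rewrite enorm_gt0.
have nY : 0 < enorm Y by rewrite enorm_gt0.
have bX a : balance X a = x a := drop_coordK x0 a.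
have bY a : balance Y a = y a := drop_coordK y0 a.
split=> //.
- apply/eqP => i0.
  have xy a : x a = - (enorm Y)^-1 * enorm X * y a.
    have : balance (inner_bisector X Y) a = 0.
      by rewrite i0 -(scale0r 0) balanceZ mul0r.
    rewrite /inner_bisector balanceD !balanceZ bX bY => /eqP.
    rewrite addr_eq0 => /eqP e.
    apply: (mulfI (lt0r_neq0 nY)); rewrite e; field; exact: lt0r_neq0.
  have : overlap x y = 0.
    rewrite /overlap big1 // => a _; rewrite xy.
    have c0 : 0 < (enorm Y)^-1 * enorm X by rewrite mulr_gt0 ?invr_gt0.
    rewrite !mulNr; have [ya|/ltW ya] := lerP 0 (y a).
      by rewrite pos0 ?min_l ?pos_ge0 // oppr_le0 mulr_ge0 // ltW.
    by rewrite [pos (y a)]pos0 // min_r ?pos_ge0.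
  by rewrite oxy => /eqP; rewrite invr_eq0 pnatr_eq0.
- apply/eqP => o0.
  have c0 : 0 < (enorm Y)^-1 * enorm X by rewrite mulr_gt0 ?invr_gt0.
  have xy a : x a = (enorm Y)^-1 * enorm X * y a.
    have : balance (outer_bisector X Y) a = 0.
      by rewrite o0 -(scale0r 0) balanceZ mul0r.
    rewrite /outer_bisector -scaleNr balanceD !balanceZ bX bY mulNr => /eqP.
    rewrite subr_eq0 => /eqP e.
    apply: (mulfI (lt0r_neq0 nY)); rewrite e; field; exact: lt0r_neq0.
  have c1 : (enorm Y)^-1 * enorm X = 1.
    rewrite -mx /mass (eq_bigr (fun a => pos ((enorm Y)^-1 * enorm X * y a))).
      by rewrite -/(mass _) massZ ?ltW // my mulr1.
    by move=> a _; rewrite -xy.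
  have : overlap x y = 1.
    rewrite -my -overlapxx; apply: eq_bigr => a _.
    by rewrite xy c1 mul1r.
  by rewrite oxy; lra.
Qed.

Definition hom_frame (p : hom_complex R C5 K) : 'M[R]_(2, n) :=
  bisector_frame (drop_coord (diff04 (val p))) (drop_coord (diff12 (val p))).

Lemma pair_point_hom (p : hom_complex R C5 K) :
  pair_point (diff04 (val p)) (diff12 (val p)).
Proof. exact: pair_point_diffs (set_mem (valP p)). Qed.

Lemma hom_frame_orthonormal (p : hom_complex R C5 K) :
  orthonormal_frames (hom_frame p).
Proof.
have [_ _ i0 o0] := pair_point_neq0 (pair_point_hom p).
exact: bisector_frame_orthonormal.
Qed.

Definition hom_to_stiefel (p : hom_complex R C5 K) : stiefel R n 2 :=
  exist _ (hom_frame p) (mem_set (hom_frame_orthonormal p)).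

Lemma continuous_hom_to_stiefel : continuous hom_to_stiefel.
Proof.
have cw i a : continuous (fun p : hom_complex R C5 K => (val p) i a).
  move=> p; have cv : {for p, continuous (set_val : hom_complex R C5 K -> _)}.
    exact: initial_continuous.
  exact: (continuous_comp cv (@continuous_weight R C5 K i a (set_val p))).
apply: continuous_to_set_type; apply: continuous_bisector_frame => [j|j|p|p].
- rewrite (_ : (fun q => _) = fun q : hom_complex R C5 K =>
      (val q c0 (lift ord0 j) + val q c3 (lift ord0 j)) / 2
      - val q c4 (lift ord0 j)).
    by apply: continuous_mean_sub; exact: cw.
  by apply/funext => q; rewrite mxE.
- rewrite (_ : (fun q => _) = fun q : hom_complex R C5 K =>
      (val q c1 (lift ord0 j) + val q c3 (lift ord0 j)) / 2
      - val q c2 (lift ord0 j)).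
    by apply: continuous_mean_sub; exact: cw.
  by apply/funext => q; rewrite mxE.
- by have [] := pair_point_neq0 (pair_point_hom p).
- by have [] := pair_point_neq0 (pair_point_hom p).
Qed.

(** Two points with the same frame lie on the same path [u + t v], [u - t v],
    on which the overlap one half is attained only once. *)
Lemma hom_to_stiefel_inj : injective hom_to_stiefel.
Proof.
have half01 : 0 < (2^-1 : R) < 1 by lra.
move=> p q /(congr1 val) /= pq; apply: val_inj.
have Pp := pair_point_hom p; have [x0 y0 mx my oxy] := Pp.
have Pq := pair_point_hom q; have [x'0 y'0 mx' my' oxy'] := Pq.
have [X0 Y0 i0 o0] := pair_point_neq0 Pp.
have [X'0 Y'0 i'0 o'0] := pair_point_neq0 Pq.
have [t [al [be [t0 al0 be0 xE yE]]]] := bisector_frame_coords X0 Y0 i0 o0.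
have [t' [al' [be' [t'0 al'0 be'0 x'E y'E]]]] :=
  bisector_frame_coords X'0 Y'0 i'0 o'0.
move: xE yE x'E y'E; rewrite -!/(hom_frame _) -pq.
set u := row 0 _; set v := row 1 _ => xE yE x'E y'E.
have coords (z : 'I_n.+1 -> R) (c s : R) : \sum_a z a = 0 ->
    drop_coord z = c *: (u + s *: v) ->
    forall a, z a = c * (balance u a + s * balance v a).
  by move=> z0 zE a; rewrite -(drop_coordK z0) zE balanceZ balanceD balanceZ.
have coordsN (z : 'I_n.+1 -> R) (c s : R) : \sum_a z a = 0 ->
    drop_coord z = c *: (u - s *: v) ->
    forall a, z a = c * (balance u a - s * balance v a).
  by move=> z0; rewrite -scaleNr => /(coords _ _ _ z0) zE a; rewrite zE mulNr.
have [||xx yy] := slide_inj al0 be0 al'0 be'0 t0 t'0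
  (coords _ _ _ x0 xE) (coordsN _ _ _ y0 yE)
  (coords _ _ _ x'0 x'E) (coordsN _ _ _ y'0 y'E) mx my mx' my'.
- by rewrite oxy.
- by rewrite oxy oxy'.
rewrite -(weightsK (set_mem (valP p))) -(weightsK (set_mem (valP q))).
by congr weights; apply/funext.
Qed.

Lemma hom_to_stiefel_surj (A : stiefel R n 2) :
  exists p : hom_complex R C5 K, hom_to_stiefel p = A.
Proof.
have A1 := set_mem (valP A); have /orthonormal2P[A00 A11 A01] := A1.
set u := row 0 (val A) in A00 A01; set v := row 1 (val A) in A11 A01.
have free (p q : R) : (forall a, p * balance u a + q * balance v a = 0) ->
    p = 0 /\ q = 0.
  move=> pq0; have w0 : p *: u + q *: v = 0.
    rewrite -[LHS]balanceK; apply/rowP => j; rewrite !mxE.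
    by rewrite balanceD !balanceZ.
  have dot0 w : dot (0 : 'rV[R]_n) w = 0 by rewrite -(scale0r 0) dotZl mul0r.
  have := dot0 u; rewrite -{1}w0 dotDl !dotZl A00 (dotC v) A01 mulr0 mulr1 addr0.
  have := dot0 v; rewrite -{1}w0 dotDl !dotZl A11 A01 mulr0 mulr1 add0r.
  by [].
have half01 : 0 < (2^-1 : R) < 1 by lra.
have [t [al [be [t0 al0 be0 [mx my oxy]]]]] :=
  slide_exists (sum_balance u) (sum_balance v) free half01.
pose X := al *: (u + t *: v); pose Y := be *: (u - t *: v).
have XE : balance X = fun a => al * (balance u a + t * balance v a).
  by apply/funext => a; rewrite balanceZ balanceD balanceZ.
have YE : balance Y = fun a => be * (balance u a - t * balance v a).
  by apply/funext => a; rewrite balanceZ -scaleNr balanceD balanceZ mulNr.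
have P : pair_point (balance X) (balance Y).
  by split; rewrite ?sum_balance // ?XE ?YE.
exists (exist _ (weights (balance X) (balance Y)) (mem_set (weights_carrier P))).
apply: val_inj => /=; rewrite /hom_frame /=.
have [/funext -> /funext ->] := diff_weights (balance X) (balance Y).
by rewrite !balanceK; exact: bisector_frame_slide A1 t0 al0 be0 _ _.
Qed.

Theorem hom_C5_complete_stiefel :
  homeomorphic (hom_complex R C5 K) (stiefel R n 2).
Proof.
apply: (compact_bijection_homeomorphic _ _ continuous_hom_to_stiefel
  hom_to_stiefel_inj hom_to_stiefel_surj).
  exact/compact_set_type/compact_hom_carrier.
apply: hausdorff_set_type.
exact: hausdorff_matrix.
Qed.

End HomC5.

(** * Quaternions and orthonormal 2-frames of 3-space *)

Section Quaternions.
Context (R : realType).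
Implicit Types (p q r : 'rV[R]_4) (w : 'rV[R]_3) (c : R).

Definition quat (a b c d : R) : 'rV[R]_4 := \row_i nth 0 [:: a; b; c; d] i.

Definition re q := q 0 (inord 0).
Definition im1 q := q 0 (inord 1).
Definition im2 q := q 0 (inord 2).
Definition im3 q := q 0 (inord 3).

Lemma quatP p q :
  re p = re q -> im1 p = im1 q -> im2 p = im2 q -> im3 p = im3 q -> p = q.
Proof.
move=> h0 h1 h2 h3; apply/rowP => -[[|[|[|[|//]]]] i4].
- by move: h0; congr (p 0 _ = q 0 _); apply: val_inj; rewrite /= inordK.
- by move: h1; congr (p 0 _ = q 0 _); apply: val_inj; rewrite /= inordK.
- by move: h2; congr (p 0 _ = q 0 _); apply: val_inj; rewrite /= inordK.
- by move: h3; congr (p 0 _ = q 0 _); apply: val_inj; rewrite /= inordK.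
Qed.

Lemma re_quat a b c d : re (quat a b c d) = a.
Proof. by rewrite /re mxE inordK. Qed.

Lemma im1_quat a b c d : im1 (quat a b c d) = b.
Proof. by rewrite /im1 mxE inordK. Qed.

Lemma im2_quat a b c d : im2 (quat a b c d) = c.
Proof. by rewrite /im2 mxE inordK. Qed.

Lemma im3_quat a b c d : im3 (quat a b c d) = d.
Proof. by rewrite /im3 mxE inordK. Qed.

Definition qmul p q := quat
  (re p * re q - im1 p * im1 q - im2 p * im2 q - im3 p * im3 q)
  (re p * im1 q + im1 p * re q + im2 p * im3 q - im3 p * im2 q)
  (re p * im2 q - im1 p * im3 q + im2 p * re q + im3 p * im1 q)
  (re p * im3 q + im1 p * im2 q - im2 p * im1 q + im3 p * re q).

Definition qconj q := quat (re q) (- im1 q) (- im2 q) (- im3 q).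
Definition qI := quat 0 1 0 0.
Definition qJ := quat 0 0 1 0.
Definition q1 := quat 1 0 0 0.
Definition pure w := quat 0 (w 0 (inord 0)) (w 0 (inord 1)) (w 0 (inord 2)).

Definition coordE := (re_quat, im1_quat, im2_quat, im3_quat).

Lemma reD p q : re (p + q) = re p + re q. Proof. by rewrite /re mxE. Qed.
Lemma im1D p q : im1 (p + q) = im1 p + im1 q. Proof. by rewrite /im1 mxE. Qed.
Lemma im2D p q : im2 (p + q) = im2 p + im2 q. Proof. by rewrite /im2 mxE. Qed.
Lemma im3D p q : im3 (p + q) = im3 p + im3 q. Proof. by rewrite /im3 mxE. Qed.
Lemma reZ c q : re (c *: q) = c * re q. Proof. by rewrite /re mxE. Qed.
Lemma im1Z c q : im1 (c *: q) = c * im1 q. Proof. by rewrite /im1 mxE. Qed.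
Lemma im2Z c q : im2 (c *: q) = c * im2 q. Proof. by rewrite /im2 mxE. Qed.
Lemma im3Z c q : im3 (c *: q) = c * im3 q. Proof. by rewrite /im3 mxE. Qed.

Definition linE := (reD, im1D, im2D, im3D, reZ, im1Z, im2Z, im3Z).

Lemma qmulA p q r : qmul p (qmul q r) = qmul (qmul p q) r.
Proof. by apply: quatP; rewrite /qmul !coordE; ring. Qed.

Lemma qmulDl p q r : qmul (p + q) r = qmul p r + qmul q r.
Proof. by apply: quatP; rewrite /qmul !(coordE, linE); ring. Qed.

Lemma qmulDr p q r : qmul r (p + q) = qmul r p + qmul r q.
Proof. by apply: quatP; rewrite /qmul !(coordE, linE); ring. Qed.

Lemma qmulZl c p q : qmul (c *: p) q = c *: qmul p q.
Proof. by apply: quatP; rewrite /qmul !(coordE, linE); ring. Qed.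

Lemma qmulZr c p q : qmul p (c *: q) = c *: qmul p q.
Proof. by apply: quatP; rewrite /qmul !(coordE, linE); ring. Qed.

Lemma qmul1 q : qmul q q1 = q.
Proof. by apply: quatP; rewrite /qmul /q1 !coordE; ring. Qed.

Lemma q1mul q : qmul q1 q = q.
Proof. by apply: quatP; rewrite /qmul /q1 !coordE; ring. Qed.

Lemma dotE p q : dot p q =
  re p * re q + im1 p * im1 q + im2 p * im2 q + im3 p * im3 q.
Proof.
rewrite /dot !big_ord_recr big_ord0 /= add0r /re /im1 /im2 /im3.
by do !congr (_ + _); congr (p 0 _ * q 0 _); apply: val_inj; rewrite /= inordK.
Qed.

Lemma qmul_conj q : qmul q (qconj q) = dot q q *: q1.
Proof. by apply: quatP; rewrite dotE /qmul /qconj /q1 !(coordE, linE); ring. Qed.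

Lemma qconj_mul q : qmul (qconj q) q = dot q q *: q1.
Proof. by apply: quatP; rewrite dotE /qmul /qconj /q1 !(coordE, linE); ring. Qed.

Lemma qconjM p q : qconj (qmul p q) = qmul (qconj q) (qconj p).
Proof. by apply: quatP; rewrite /qmul /qconj !(coordE, linE); ring. Qed.

Lemma dot3E w w' : dot w w' = w 0 (inord 0) * w' 0 (inord 0) +
  w 0 (inord 1) * w' 0 (inord 1) + w 0 (inord 2) * w' 0 (inord 2).
Proof.
rewrite /dot !big_ord_recr big_ord0 /= add0r.
by do !congr (_ + _); congr (w 0 _ * w' 0 _); apply: val_inj; rewrite /= inordK.
Qed.

Lemma re_pure_mul w w' : re (qmul (pure w) (pure w')) = - dot w w'.
Proof. by rewrite dot3E /qmul /pure !coordE; ring. Qed.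

Lemma pure_sqr w : dot w w = 1 -> qmul (pure w) (pure w) = - 1 *: q1.
Proof.
move=> w1; apply: quatP; first by rewrite re_pure_mul w1 linE coordE; ring.
all: by rewrite /qmul /pure /q1 !(linE, coordE); ring.
Qed.

Lemma pure_anticomm w w' : dot w w' = 0 ->
  qmul (pure w) (pure w') = - 1 *: qmul (pure w') (pure w).
Proof.
move=> ww'; apply: quatP; first by rewrite linE !re_pure_mul (dotC w') ww'; ring.
all: by rewrite /qmul /pure !(linE, coordE); ring.
Qed.

(** For [q != 0] these equations say that the rotation [p |-> q p q^-1] carries
    [qI] and [qJ] to the two rows of [A]; in this form they are linear in
    [q]. *)
Definition spins q (A : 'M[R]_(2, 3)) :=
  qmul (pure (row 0 A)) q = qmul q qI /\ qmul (pure (row 1 A)) q = qmul q qJ.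

(** For orthogonal unit rows [r], [s], the maps [f] and [g] send any quaternion
    to a solution of the first and of the second equation, and [g] preserves
    the first one.  The trace of [g \o f] is 4, so some basis quaternion has a
    nonzero image. *)
Lemma exists_spin (A : 'M[R]_(2, 3)) : orthonormal_frames A ->
  exists2 q, q != 0 & spins q A.
Proof.
move=> /orthonormal2P[A00 A11 A01].
set r := pure (row 0 A); set s := pure (row 1 A).
have rr : qmul r r = - 1 *: q1 := pure_sqr A00.
have ss : qmul s s = - 1 *: q1 := pure_sqr A11.
have rs : qmul r s = - 1 *: qmul s r := pure_anticomm A01.
have II : qmul qI qI = - 1 *: q1.
  by apply: quatP; rewrite /qmul /qI /q1 !(coordE, linE); ring.
have JJ : qmul qJ qJ = - 1 *: q1.
  by apply: quatP; rewrite /qmul /qJ /q1 !(coordE, linE); ring.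
have JI : qmul qJ qI = - 1 *: qmul qI qJ.
  by apply: quatP; rewrite /qmul /qI /qJ !(coordE, linE); ring.
pose f p := p + - 1 *: qmul r (qmul p qI).
pose g p := p + - 1 *: qmul s (qmul p qJ).
have fE p : qmul r (f p) = qmul (f p) qI.
  rewrite /f qmulDr qmulDl qmulZr qmulZl !qmulA rr -!qmulA II !qmulZl q1mul.
  by rewrite !qmulZr qmul1 !scalerA mulrNN mulr1 !scale1r addrC.
have gE p : qmul s (g p) = qmul (g p) qJ.
  rewrite /g qmulDr qmulDl qmulZr qmulZl !qmulA ss -!qmulA JJ !qmulZl q1mul.
  by rewrite !qmulZr qmul1 !scalerA mulrNN mulr1 !scale1r addrC.
have gfE p : qmul r p = qmul p qI -> qmul r (g p) = qmul (g p) qI.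
  move=> rp; rewrite /g qmulDr qmulDl rp qmulZr qmulZl; congr (_ + _ *: _).
  rewrite qmulA rs qmulZl -!qmulA [qmul r _]qmulA rp JI !qmulZr.
  by rewrite -!qmulA.
have spinP p : spins (g (f p)) A by split; [exact: gfE|exact: gE].
(* The trace of [g \o f]: the terms that contain [r] or [s] cancel. *)
have total : re (g (f q1)) + im1 (g (f qI)) + im2 (g (f qJ)) +
    im3 (g (f (quat 0 0 0 1))) = 4.
  have fQ a b c d : f (quat a b c d) = quat
      (a + im1 r * a + im2 r * d - im3 r * c)
      (b + im1 r * b + im2 r * c + im3 r * d)
      (c + im2 r * b - im3 r * a - im1 r * c)
      (d + im3 r * b - im1 r * d + im2 r * a).
    have r0 : re r = 0 by rewrite /r /pure coordE.
    by apply: quatP; rewrite /f /qmul /qI !(coordE, linE) ?r0; ring.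
  have gQ a b c d : g (quat a b c d) = quat
      (a - im1 s * d + im2 s * a + im3 s * b)
      (b + im1 s * c - im2 s * b + im3 s * a)
      (c + im2 s * c + im3 s * d + im1 s * b)
      (d + im3 s * c - im1 s * a - im2 s * d).
    have s0 : re s = 0 by rewrite /s /pure coordE.
    by apply: quatP; rewrite /g /qmul /qJ !(coordE, linE) ?s0; ring.
  by rewrite !fQ !gQ !coordE; ring.
apply: contrapT => none.
have z p : g (f p) = 0.
  by apply: contrapT => /eqP nz; apply: none; exists (g (f p)).
by move: total; rewrite !z /re /im1 /im2 /im3 !mxE; lra.
Qed.

(** [qconj q * q'] commutes with [qI] and [qJ], hence is a real number. *)
Lemma spin_unique q q' A : q != 0 -> spins q A -> spins q' A ->
  exists c, q' = c *: q.
Proof.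
move=> q0 [qi qj] [q'i q'j].
have n0 : dot q q != 0 by rewrite dot_eq0.
pose h := qmul (qconj q) q'.
have q'E : q' = (dot q q)^-1 *: qmul q h.
  by rewrite /h qmulA qmul_conj qmulZl q1mul scalerA mulVf ?scale1r.
have conj_pure w : qconj (pure w) = - 1 *: pure w.
  by apply: quatP; rewrite /qconj /pure !(coordE, linE); ring.
have conjI : qconj qI = - 1 *: qI.
  by apply: quatP; rewrite /qconj /qI !(coordE, linE); ring.
have conjJ : qconj qJ = - 1 *: qJ.
  by apply: quatP; rewrite /qconj /qJ !(coordE, linE); ring.
have N1 : (- 1 : R) != 0 by rewrite oppr_eq0 oner_eq0.
have ci : qmul (qconj q) (pure (row 0 A)) = qmul qI (qconj q).
  apply: (scalerI N1); rewrite -qmulZr -qmulZl -conj_pure -conjI -!qconjM.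
  by rewrite qi.
have cj : qmul (qconj q) (pure (row 1 A)) = qmul qJ (qconj q).
  apply: (scalerI N1); rewrite -qmulZr -qmulZl -conj_pure -conjJ -!qconjM.
  by rewrite qj.
have hI : qmul h qI = qmul qI h by rewrite /h -qmulA -q'i qmulA ci -qmulA.
have hJ : qmul h qJ = qmul qJ h by rewrite /h -qmulA -q'j qmulA cj -qmulA.
clearbody h.
have i2 : im2 h = 0.
  by have := congr1 im3 hI; rewrite /qmul /qI !coordE; lra.
have i3 : im3 h = 0.
  by have := congr1 im2 hI; rewrite /qmul /qI !coordE; lra.
have i1 : im1 h = 0.
  by have := congr1 im3 hJ; rewrite /qmul /qJ !coordE; lra.
exists ((dot q q)^-1 * re h); rewrite -scalerA {1}q'E; congr (_ *: _).
by apply: quatP; rewrite /qmul !(coordE, linE) i1 i2 i3; ring.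
Qed.

Definition imag q : 'rV[R]_3 := \row_j nth 0 [:: im1 q; im2 q; im3 q] j.

Definition rotate q p := (dot q q)^-1 *: qmul (qmul q p) (qconj q).

Definition quat_frame q : 'M[R]_(2, 3) :=
  frame (imag (rotate q qI)) (imag (rotate q qJ)).

Lemma pure_imag p : re p = 0 -> pure (imag p) = p.
Proof. by move=> p0; apply: quatP; rewrite /pure !coordE ?p0 ?mxE ?inordK. Qed.

Lemma imag_pure w : imag (pure w) = w.
Proof.
apply/rowP => -[[|[|[|//]]] i3]; rewrite mxE /= !coordE; congr (w 0 _);
by apply: val_inj; rewrite /= inordK.
Qed.

Lemma re_rotate q p : re p = 0 -> re (rotate q p) = 0.
Proof.
move=> p0; rewrite /rotate linE; apply/eqP; rewrite mulf_eq0; apply/orP; right.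
by apply/eqP; rewrite /qmul /qconj !coordE p0; ring.
Qed.

Lemma spins_quat_frame q : q != 0 -> spins q (quat_frame q).
Proof.
move=> q0; have n0 : dot q q != 0 by rewrite dot_eq0.
have rotateK p : qmul (rotate q p) q = qmul q p.
  by rewrite /rotate qmulZl -qmulA qconj_mul qmulZr qmul1 scalerA mulVf ?scale1r.
rewrite /spins row_frame0 row_frame1 !pure_imag ?rotateK //;
  by rewrite re_rotate // coordE.
Qed.

Lemma spins_frame q A : q != 0 -> spins q A -> quat_frame q = A.
Proof.
move=> q0 [qi qj]; have n0 : dot q q != 0 by rewrite dot_eq0.
have E w p : qmul (pure w) q = qmul q p -> imag (rotate q p) = w.
  move=> wq; rewrite /rotate -wq -qmulA qmul_conj qmulZr qmul1 scalerA mulVf //.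
  by rewrite scale1r imag_pure.
by rewrite /quat_frame (E _ _ qi) (E _ _ qj) frame_rows.
Qed.

Lemma quat_frame_orthonormal q : q != 0 -> orthonormal_frames (quat_frame q).
Proof.
move=> q0; have n0 : dot q q != 0 by rewrite dot_eq0.
have rotateM p p' : qmul (rotate q p) (rotate q p') = rotate q (qmul p p').
  rewrite /rotate qmulZl qmulZr; congr (_ *: _).
  rewrite -!qmulA [qmul (qconj q) _]qmulA qconj_mul qmulZl q1mul !qmulZr.
  by rewrite scalerA mulVf ?scale1r.
have rI : re (rotate q qI) = 0 by rewrite re_rotate // coordE.
have rJ : re (rotate q qJ) = 0 by rewrite re_rotate // coordE.
have dotR p p' : re (rotate q p) = 0 -> re (rotate q p') = 0 ->
    dot (imag (rotate q p)) (imag (rotate q p')) = - re (rotate q (qmul p p')).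
  move=> h h'; rewrite -rotateM -{2}(pure_imag h) -{2}(pure_imag h').
  by rewrite re_pure_mul opprK.
have re1 p : re (rotate q p) = re p.
  apply: (mulfI n0); rewrite /rotate linE mulrA divff // mul1r dotE.
  by rewrite /qmul /qconj !coordE; ring.
apply/orthonormal_frameP; rewrite !dotR // !re1.
by split; rewrite /qmul /qI /qJ !coordE; ring.
Qed.

End Quaternions.

(** * Projective 3-space *)

Section Projective.
Local Open Scope quotient_scope.
Context (R : realType).

Lemma nonzero_vectorP n (v : @nonzero_vectors R n) : val v != 0.
Proof. exact: set_mem (valP v). Qed.

Definition line n (v : @nonzero_vectors R n) : real_projective_space R n :=
  \pi_({eq_quot (@same_line_equiv R n)}) v.

Lemma continuous_line n : continuous (@line n).
Proof. exact: pi_continuous. Qed.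

Lemma lineP n (u v : @nonzero_vectors R n) :
  line u = line v <-> exists2 c : R, c != 0 & val v = c *: val u.
Proof.
have E : reflect (line u = line v) (same_line u v).
  exact: (@eqmodP _ (@same_line_equiv R n) u v).
by split=> [/E/asboolP|uv] //; apply/E/asboolP.
Qed.

(** The unit sphere meets every line. *)
Lemma compact_projective n : compact [set: real_projective_space R n].
Proof.
pose S := [set v : 'rV[R]_n.+1 | dot v v = 1].
have cS : compact S.
  have cbox :
      compact [set v : 'rV[R]_n.+1 | forall i, `[-1, 1]%classic (v 0 i)].
    apply: (@rV_compact R n.+1 (fun=> `[-1, 1]%classic)) => i.
    exact: segment_compact.
  apply: (subclosed_compact _ cbox) => [|v v1 i].
    apply: (@preimage_closed _ _ (fun v : 'rV[R]_n.+1 => dot v v)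
      [set r : R | r = 1]).
      move=> v _; apply: continuous_sum => i w.
      exact: (cvgM (@coord_continuous R 1 n.+1 0 i w)
        (@coord_continuous R 1 n.+1 0 i w)).
    exact: closed_eq.
  rewrite /= in_itv /= -ler_norml -(@expr_le1 _ 2) // real_normK ?num_real //.
  rewrite -v1 /dot (bigD1 i) //= -expr2 lerDl sumr_ge0 // => j _.
  by rewrite -expr2 sqr_ge0.
have S_neq0 (v : set_type S) : nonzero_vectors (val v).
  apply/eqP => v0; have := set_mem (valP v); rewrite /S /= v0.
  by rewrite -(scale0r 0) dotZl mul0r => /eqP; rewrite eq_sym oner_eq0.
pose h (v : set_type S) : @nonzero_vectors R n :=
  exist _ (val v) (mem_set (S_neq0 v)).
have ch : continuous h.
  by apply: continuous_to_set_type; exact: initial_continuous.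
have -> : [set: real_projective_space R n] =
    (@line n \o h) @` [set: set_type S].
  apply/seteqP; split=> // x _.
  have [v ->] : exists v, x = line v by exists (repr x); rewrite /line reprK.
  have v0 := nonzero_vectorP v.
  exists (exist _ (normalize (val v)) (mem_set (dot_normalize v0 : S _))) => //.
  apply/lineP; exists (enorm (val v)); first by rewrite gt_eqF ?enorm_gt0.
  by rewrite /= enormK.
apply: continuous_compact; last exact: compact_set_type.
apply: continuous_subspaceT => v; apply: continuous_comp; first exact: ch.
exact: continuous_line.
Qed.

Definition frame_of_vector (v : @nonzero_vectors R 3) : stiefel R 3 2 :=
  exist _ (quat_frame (val v))
    (mem_set (quat_frame_orthonormal (nonzero_vectorP v))).

(** Rotations are unit quaternions up to sign, and a rotation of 3-space is
    determined by the images of two orthogonal vectors. *)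
Lemma frame_of_vectorP u v :
  frame_of_vector u = frame_of_vector v <-> line u = line v.
Proof.
have u0 := nonzero_vectorP u; have v0 := nonzero_vectorP v.
split=> [/(congr1 val) /= uv|/lineP[c c0 vE]].
  have su := spins_quat_frame u0; have sv := spins_quat_frame v0.
  rewrite -uv in sv; have [c vE] := spin_unique u0 su sv.
  apply/lineP; exists c => //; apply: contraNneq v0 => c0.
  by rewrite vE c0 scale0r.
apply: val_inj => /=; apply: spins_frame => //.
have [si sj] := spins_quat_frame v0.
have cK p p' : qmul p (val v) = qmul (val v) p' ->
    qmul p (val u) = qmul (val u) p'.
  by rewrite vE qmulZr qmulZl => /(scalerI c0).
by split; exact: cK.
Qed.

Section QuaternionContinuity.
Context (X : topologicalType).
Implicit Types (f g : X -> 'rV[R]_4) (a b c d : X -> R).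

Definition coords_continuous f := [/\ continuous (fun x => re (f x)),
  continuous (fun x => im1 (f x)), continuous (fun x => im2 (f x)) &
  continuous (fun x => im3 (f x))].

Lemma coords_continuous_quat a b c d :
  continuous a -> continuous b -> continuous c -> continuous d ->
  coords_continuous (fun x => quat (a x) (b x) (c x) (d x)).
Proof.
move=> ca cb cc cd; split.
- by rewrite (_ : (fun x => _) = a) //; apply/funext => x; rewrite re_quat.
- by rewrite (_ : (fun x => _) = b) //; apply/funext => x; rewrite im1_quat.
- by rewrite (_ : (fun x => _) = c) //; apply/funext => x; rewrite im2_quat.
- by rewrite (_ : (fun x => _) = d) //; apply/funext => x; rewrite im3_quat.
Qed.

Lemma coords_continuous_qmul f g : coords_continuous f -> coords_continuous g ->
  coords_continuous (fun x => qmul (f x) (g x)).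
Proof.
move=> [f0 f1 f2 f3] [g0 g1 g2 g3].
have M (a b : X -> R) x : continuous a -> continuous b ->
    a y * b y @[y --> x] --> a x * b x.
  by move=> ca cb; exact: (cvgM (ca x) (cb x)).
apply: coords_continuous_quat => x.
- exact: (cvgB (cvgB (cvgB (M _ _ _ f0 g0) (M _ _ _ f1 g1)) (M _ _ _ f2 g2))
    (M _ _ _ f3 g3)).
- exact: (cvgB (cvgD (cvgD (M _ _ _ f0 g1) (M _ _ _ f1 g0)) (M _ _ _ f2 g3))
    (M _ _ _ f3 g2)).
- exact: (cvgD (cvgD (cvgB (M _ _ _ f0 g2) (M _ _ _ f1 g3)) (M _ _ _ f2 g0))
    (M _ _ _ f3 g1)).
- exact: (cvgD (cvgB (cvgD (M _ _ _ f0 g3) (M _ _ _ f1 g2)) (M _ _ _ f2 g1))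
    (M _ _ _ f3 g0)).
Qed.

Lemma continuous_quat_frame f :
  continuous f -> (forall x, f x != 0) -> continuous (fun x => quat_frame (f x)).
Proof.
move=> cf f0.
have ccoord k : continuous (fun x => f x 0 k).
  move=> x; apply: (@continuous_comp _ _ _ f (fun q => q 0 k)); first exact: cf.
  exact: coord_continuous.
have cq : coords_continuous f by split; exact: ccoord.
have crot p j : continuous (fun x => imag (rotate (f x) p) 0 j).
  have cinv : continuous (fun x => (dot (f x) (f x))^-1).
    move=> x; apply: cvgV; first by rewrite dot_eq0.
    by apply: continuous_sum => k y; apply: cvgM; exact: ccoord.
  have [_ c1 c2 c3] :
      coords_continuous (fun x => qmul (qmul (f x) p) (qconj (f x))).
    apply: coords_continuous_qmul.
      by apply: coords_continuous_qmul => //; split; exact: cst_continuous.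
    case: cq => q0 q1 q2 q3.
    by apply: coords_continuous_quat => // x; apply: cvgN;
      [exact: q1|exact: q2|exact: q3].
  rewrite (_ : (fun x => _) = fun x => (dot (f x) (f x))^-1 *
    nth 0 [:: im1 (qmul (qmul (f x) p) (qconj (f x)));
      im2 (qmul (qmul (f x) p) (qconj (f x)));
      im3 (qmul (qmul (f x) p) (qconj (f x)))] j); last first.
    apply/funext => x; rewrite mxE /rotate !linE.
    by case: j => [[|[|[|//]]] j3].
  move=> x; apply: cvgM; first exact: cinv.
  by case: j => [[|[|[|//]]] j3]; [exact: c1|exact: c2|exact: c3].
by apply: continuous_frame.
Qed.

End QuaternionContinuity.

Lemma continuous_frame_of_vector : continuous frame_of_vector.
Proof.
apply: continuous_to_set_type.
apply: continuous_quat_frame; last exact: nonzero_vectorP.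
exact: initial_continuous.
Qed.

Definition frame_of_line (l : real_projective_space R 3) : stiefel R 3 2 :=
  frame_of_vector (repr l).

Lemma frame_of_lineE v : frame_of_line (line v) = frame_of_vector v.
Proof. by apply/frame_of_vectorP; rewrite /line reprK. Qed.

Lemma line_surj n (l : real_projective_space R n) : exists v, line v = l.
Proof. by exists (repr l); rewrite /line reprK. Qed.

Lemma continuous_frame_of_line : continuous frame_of_line.
Proof.
apply/quotient_continuous; rewrite (_ : _ \o _ = frame_of_vector).
  exact: continuous_frame_of_vector.
by apply/funext => v; exact: frame_of_lineE.
Qed.

Theorem projective_stiefel :
  homeomorphic (real_projective_space R 3) (stiefel R 3 2).
Proof.
apply: (compact_bijection_homeomorphic _ _ continuous_frame_of_line).
- exact: compact_projective.
- apply: hausdorff_set_type; exact: hausdorff_matrix.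
- move=> l m; have [u <-] := line_surj l; have [v <-] := line_surj m.
  by rewrite !frame_of_lineE => /frame_of_vectorP.
- move=> A; have [q q0 qA] := exists_spin (set_mem (valP A)).
  exists (line (exist _ q (mem_set q0))); rewrite frame_of_lineE.
  by apply: val_inj; exact: spins_frame.
Qed.

End Projective.

(** * The two homeomorphisms *)

Theorem theorem13 (R : realType) :
  homeomorphic (hom_complex R (cycle_graph 5) (complete_graph 4))
               (stiefel R 3 2) /\
  homeomorphic (stiefel R 3 2) (real_projective_space R 3).
Proof.
split; first exact: hom_C5_complete_stiefel.
exact/homeomorphic_sym/projective_stiefel.
Qed.
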